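(* Let $R$ be a finite local commutative ring other than a field and $K$ a pure subgroup of $R^\times$. Then the scheme $\mathrm{Cyc}(K,R)$ is normal whenever $K\le\mathcal T\mathcal U_0$.
   Context: All rings have an identity. For a finite local commutative ring $R$ with maximal ideal $\mathrm{rad}(R)$ and residue field of order $q$: $\mathcal T$ is the (cyclic) subgroup of $R^\times$ of order $q-1$ (Teichmüller group), $I_0=\{x\in\mathrm{rad}(R): x\,\mathrm{rad}(R)=\{0\}\}$, $\mathcal U_0=1+I_0$. $K$ is pure if the only ideal $I$ with $1+I\subseteq K$ is $\{0\}$. $\mathrm{Cyc}(K,R)$ is the pair $(R,\mathrm{Rel}(K,R))$ with $\mathrm{Rel}(K,R)$ the relations $\{(x,y): y-x\in rK\}$, $r\in R$; its automorphism group consists of the permutations of $R$ fixing each such relation; it is normal if this group is contained in $\mathrm{A\Gamma L}_1(R)$, the group of permutations $x\mapsto ax^\sigma+b$, $a\in R^\times$, $b\in R$, $\sigma\in\mathrm{Aut}(R)$. *)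

(* Defs.v *)
From HB Require Import structures.
From mathcomp Require Import all_boot all_order all_algebra all_fingroup.
Set Implicit Arguments. Unset Strict Implicit. Unset Printing Implicit Defensive.
Import GRing.Theory.
Local Open Scope ring_scope.

Section Defs.
Variable R : finComUnitRingType.

Definition is_ideal (I : {set R}) : Prop :=
  [/\ 0 \in I,
      (forall x y, x \in I -> y \in I -> x - y \in I) &
      (forall r x, x \in I -> r * x \in I)].

Definition nonunits : {set R} := [set x | x \isn't a GRing.unit].

(* R is local: it has a unique maximal ideal, i.e. the non-units form an ideal *)
Definition local_ring : Prop := is_ideal nonunits.

Definition rad : {set R} := nonunits.

Definition not_field : Prop := exists x : R, x != 0 /\ x \isn't a GRing.unit.

(* order of the residue field R / rad(R) *)
Definition resq : nat := (#|[set: R]| %/ #|rad|)%N.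

Definition I0 : {set R} := [set x in rad | [forall y in rad, x * y == 0]].

Definition U0 : {set {unit R}} := [set u : {unit R} | val u - 1 \in I0].

Definition Kset (K : {set {unit R}}) : {set R} := [set val k | k in K].

Definition pure (K : {set {unit R}}) : Prop :=
  forall I : {set R}, is_ideal I ->
    (forall x, x \in I -> 1 + x \in Kset K) -> I = [set 0].

Definition cyc_rel (K : {set {unit R}}) (r : R) (x y : R) : bool :=
  [exists k in K, y - x == r * val k].

Definition cyc_aut (K : {set {unit R}}) (g : {perm R}) : Prop :=
  forall r x y, cyc_rel K r (g x) (g y) = cyc_rel K r x y.

Definition in_AGammaL1 (g : R -> R) : Prop :=
  exists (a : {unit R}) (b : R) (sigma : {rmorphism R -> R}),
    bijective sigma /\ forall x, g x = val a * sigma x + b.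

Definition cyc_normal (K : {set {unit R}}) : Prop :=
  forall g : {perm R}, cyc_aut K g -> in_AGammaL1 g.

End Defs.

(* Main.v *)
(* Let F = R/rad(R), q = |F|, and 1 + A = K :&: U0.  As q kills I0, taking q-th
   powers shows K = (K :&: T)(1 + A), where A is an additive subgroup of I0 and
   purity says that A contains no nonzero ideal.  After an affine change, g fixes
   0 and 1, and g y - g x = (y - x) t (1 + a) with t in T, a in A.

   If rad(R) <> I0, moving y by s in rad(R) \ I0 shows that t depends on y only,
   hence t = 1 by symmetry.  If rad(R) = I0, moving y by s in I0 shows that
   (g(y + s) - g y) / (g y - g(y - 1/z)) - s z lies in A, so that
   1 / (g y - g(y - 1/z)) is additive in z modulo rad(R), for every y.
   A variant of Hua's theorem then makes g a ring automorphism modulo rad(R).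
   In both cases g is semilinear on I0 and g(y + s) = g y + g s for s in I0.

   Write g t = tau(t)(1 + f t) for t in T, where tau(t) in T.  Then f (r t) - f t
   lies in (tau r - 1) A up to a constant depending on r, which vanishes after
   averaging over t; a stabiliser argument in T makes f constant, so g = tau on T.
   Thus g = id in the first case, and g is multiplicative in the second.  There,
   g(a^p + 1) - g(a^p) - 1 = P(g a)(p - g p) lies in A for all a, where
   P = ((X + 1)^p - X^p - 1) / p has degree p - 1; the values of P generate F
   additively, whence (p - g p) R lies in A, g p = p, and g is additive. *)
From HB Require Import structures.
Require Import Defs.
From mathcomp Require Import all_boot all_order all_algebra all_fingroup.
From mathcomp Require Import finfield cyclic ring.
Set Implicit Arguments. Unset Strict Implicit. Unset Printing Implicit Defensive.
Import GRing.Theory.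
Local Open Scope ring_scope.

(** * The residue field *)

Section ResidueField.
Variables (R : finComUnitRingType) (locR : local_ring R).

(** The proof of locality is a phantom argument, so that the ideal structure can be attached to this
    predicate. *)
Definition nonunit of local_ring R : {pred R} := fun x => x \isn't a GRing.unit.

Lemma nonunit_idealr_closed : idealr_closed (nonunit locR).
Proof.
have [z0 IB IM] := locR.
have E x : (x \in nonunits R) = (x \in nonunit locR) by rewrite inE.
split=> [|| a x y]; rewrite -?E //; first by rewrite inE unitr1.
move=> xI yI; rewrite -(opprK y) IB ?IM // -sub0r; exact: IB.
Qed.

HB.instance Definition _ :=
  isIdealr.Build R (nonunit locR) nonunit_idealr_closed.

Definition residue_field : Type := {ideal_quot (nonunit locR)}.
HB.instance Definition _ := GRing.ComNzRing.on residue_field.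
HB.instance Definition _ := EqQuotient.on residue_field.

Definition residue : {rmorphism R -> residue_field} := \pi_residue_field%qT.

Lemma residueE x : (residue x == 0) = (x \isn't a GRing.unit).
Proof.
have <- : residue 0 = 0 by rewrite raddf0.
rewrite -[x in RHS]subr0 -[RHS]/(x - 0 \in nonunit locR).
by rewrite (Quotient.idealrBE (nonunit locR)).
Qed.

Lemma residue_surj y : exists x, y = residue x.
Proof. by exists (generic_quotient.repr y); rewrite /residue /= generic_quotient.reprK. Qed.

Definition residue_inv (y : residue_field) : residue_field :=
  if y == 0 then 0 else residue (generic_quotient.repr y)^-1.

Lemma residue_mulVf y : y != 0 -> residue_inv y * y = 1.
Proof.
rewrite /residue_inv => y0; rewrite (negbTE y0).
have Ey : y = residue (generic_quotient.repr y) by rewrite /residue /= generic_quotient.reprK.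
rewrite [X in _ * X]Ey -rmorphM mulVr ?rmorph1 //.
by rewrite Ey residueE negbK in y0.
Qed.

Lemma residue_inv0 : residue_inv 0 = 0.
Proof. by rewrite /residue_inv eqxx. Qed.

HB.instance Definition _ :=
  GRing.ComNzRing_isField.Build residue_field residue_mulVf residue_inv0.
HB.instance Definition _ : isCountable residue_field :=
  CanIsCountable (@generic_quotient.reprK _ residue_field).
HB.instance Definition _ : isFinite residue_field :=
  CanIsFinite (@generic_quotient.reprK _ residue_field : cancel (_ : residue_field -> R) _).
End ResidueField.

Lemma exists_residue_field (R : finComUnitRingType) : local_ring R ->
  exists (F : finFieldType) (pi : {rmorphism R -> F}),
    (forall x, (pi x == 0) = (x \isn't a GRing.unit)) /\ forall y, exists x, y = pi x.
Proof.
move=> H; exists (residue_field H), (residue H).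
by split=> [x|y]; [apply: residueE|apply: residue_surj].
Qed.

(** * A variant of Hua's theorem *)

Section HuaFiniteField.
Variables (F : finFieldType) (h : F -> F).
Hypotheses (h_inj : injective h) (h0 : h 0 = 0) (h1 : h 1 = 1).
Hypothesis h_chord : forall y u v,
  (h y - h (y - (u + v)^-1))^-1
    = (h y - h (y - u^-1))^-1 + (h y - h (y - v^-1))^-1.

Let k z := (h z^-1)^-1.

Lemma hua_eq0 x : (h x == 0) = (x == 0).
Proof. by rewrite -[RHS](inj_eq h_inj) h0. Qed.

(** In the chord identity at 0, opposite [u] and [v] make the left side the inverse of 0, so the two
    terms on the right cancel. *)
Lemma huaN x : h (- x) = - h x.
Proof.
have [->|x0] := eqVneq x 0; first by rewrite oppr0 h0 oppr0.
have := h_chord 0 x^-1 (- x^-1).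
rewrite subrr invr0 !subr0 h0 subrr invr0 !sub0r !(invrN, invrK, opprK) => /esym/eqP.
by rewrite addr_eq0 => /eqP /oppr_inj E; apply: invr_inj; rewrite E -invrN.
Qed.

Lemma hua_dualD u v : k (u + v) = k u + k v.
Proof. by have := h_chord 0 u v; rewrite /k h0 !sub0r !huaN !opprK. Qed.

Lemma hua_dualK x : h x = (k x^-1)^-1.
Proof. by rewrite /k !invrK. Qed.

Lemma hua_dual_eq0 x : (k x == 0) = (x == 0).
Proof. by rewrite /k invr_eq0 hua_eq0 invr_eq0. Qed.

Lemma hua_dual1 : k 1 = 1.
Proof. by rewrite /k invr1 h1 invr1. Qed.

(* The chord at 1 is a translate of [h] itself: this makes [h] additive. *)
Lemma hua_chord1 z : (h 1 - h (1 - z^-1))^-1 = 1 + h (z - 1).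
Proof.
have [->|z0] := eqVneq z 0; first by rewrite invr0 subr0 subrr invr0 sub0r huaN h1 subrr.
have [->|z1] := eqVneq z 1; first by rewrite invr1 subrr h0 h1 subr0 addr0 invr1.
have w0 : z - 1 != 0 by rewrite subr_eq0.
have e : (1 - z^-1)^-1 = 1 + (z - 1)^-1 by field; rewrite z0 w0.
rewrite (hua_dualK (1 - z^-1)) e hua_dualD hua_dual1 /k invrK h1.
have hw : h (z - 1) != 0 by rewrite hua_eq0.
have hz : 1 + h (z - 1) != 0.
  suff: h (z - 1) != h (- 1) by rewrite huaN h1 -subr_eq0 opprK addrC.
  by rewrite (inj_eq h_inj) -subr_eq0 opprK subrK.
by field; rewrite hw [h _ + 1]addrC hz addrK oner_eq0.
Qed.

(** Splitting off 1 from [x + 1] in the chord at 1 identifies [h x] with that chord at [x], and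
    chords are additive. *)
Lemma huaD u v : h (u + v) = h u + h v.
Proof.
have H x : 1 + h x = (h 1 - h (1 - (x + 1)^-1))^-1 by rewrite hua_chord1 addrK.
have E x : h x = (h 1 - h (1 - x^-1))^-1.
  apply: (addrI 1); rewrite H h_chord addrC; congr (_ + _).
  by rewrite invr1 subrr h0 h1 subr0 invr1.
by rewrite E h_chord -!E.
Qed.

(** Hua's identity [x ^+ 2 / y + x = (x^-1 - (x + y)^-1)^-1]: both [h] and [k] are additive, and
    inversion exchanges them. *)
Lemma hua_quot x y : y != 0 -> k (x ^+ 2 / y) = k x ^+ 2 / k y.
Proof.
move=> y0.
have kN z : k (- z) = - k z by rewrite /k invrN huaN invrN.
have [->|x0] := eqVneq x 0.
  by rewrite expr0n mul0r /k invr0 h0 invr0 expr0n mul0r.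
have kx0 : k x != 0 by rewrite hua_dual_eq0.
have ky0 : k y != 0 by rewrite hua_dual_eq0.
have [/eqP|xy0] := eqVneq (x + y) 0.
  rewrite addr_eq0 => /eqP ->; rewrite kN !sqrrN !expr2 !mulfK //.
have kxy0 : k x + k y != 0 by rewrite -hua_dualD hua_dual_eq0.
have e : x ^+ 2 / y + x = (x^-1 - (x + y)^-1)^-1.
  by field; rewrite x0 xy0 mulN1r addrAC subrr add0r y0.
have hB u v : h (u - v) = h u - h v by rewrite huaD huaN.
apply: (addIr (k x)); rewrite -hua_dualD e.
have kV z : h z^-1 = (k z)^-1 by rewrite /k invrK.
rewrite {1}/k invrK hB !kV hua_dualD.
by field; rewrite ky0 kxy0 kx0.
Qed.

Lemma hua_dualE x : k x = h x.
Proof.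
have [->|x0] := eqVneq x 0; first by rewrite h0 /k invr0 h0 invr0.
have := hua_quot 1 (_ : x^-1 != 0); rewrite invr_eq0 => /(_ x0).
by rewrite hua_dual1 !expr1n !mul1r invrK -hua_dualK.
Qed.

(** The rule [S] polarises at [x + 1] when 2 can be cancelled; in characteristic 2 every element is
    a square. *)
Lemma huaM x y : h (x * y) = h x * h y.
Proof.
have S a b : h (a ^+ 2 * b) = h a ^+ 2 * h b.
  have [->|b0] := eqVneq b 0; first by rewrite !(mulr0, h0).
  have := hua_quot a (_ : b^-1 != 0); rewrite invr_eq0 => /(_ b0).
  by rewrite invrK hua_dualE => ->; rewrite -hua_dualK hua_dualE.
have [two0|two] := eqVneq (2%:R : F) 0; last first.
  apply: (mulfI two).
  have := S (x + 1) y.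
  have -> : (x + 1) ^+ 2 * y = x ^+ 2 * y + (x * y + x * y) + y by ring.
  rewrite !huaD S h1 => E.
  have -> : 2%:R * h (x * y) = (h x ^+ 2 * h y + (h (x * y) + h (x * y)) + h y)
    - h x ^+ 2 * h y - h y by ring.
  by rewrite E; ring.
have sq_inj : injective (fun a : F => a ^+ 2).
  move=> a b /= /eqP; rewrite -subr_eq0 => /eqP E.
  apply/eqP; rewrite -subr_eq0 -sqrf_eq0; apply/eqP.
  have -> : (a - b) ^+ 2 = a ^+ 2 - b ^+ 2 + 2%:R * (b ^+ 2 - a * b) by ring.
  by rewrite E two0 mul0r addr0.
have [sq _ sqK] := injF_bij sq_inj.
rewrite -[x]sqK; move: (sq x) => a.
have S1 : h (a ^+ 2) = h a ^+ 2 by rewrite -[a ^+ 2]mulr1 S h1 mulr1.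
by rewrite S S1.
Qed.
End HuaFiniteField.

(** * Values of polynomials of degree less than p *)

Lemma coef_comp_polyXD1 (R : comNzRingType) (Q : {poly R}) m j : (size Q <= m)%N ->
  (Q \Po ('X + 1))`_j = \sum_(i < m) Q`_i *+ 'C(i, j).
Proof.
move=> sQ; rewrite comp_polyE coef_sum.
rewrite (big_ord_widen m (fun i => (Q`_i *: ('X + 1) ^+ i)`_j)) //.
rewrite big_mkcond /=; apply: eq_bigr => i _.
have E : (('X + 1 : {poly R}) ^+ i)`_j = 'C(i, j)%:R.
  rewrite exprD1n coef_sum; have [ji|ij] := leqP j i.
    rewrite (bigD1 (Ordinal (ji : j < i.+1)%N)) //= coefMn coefXn eqxx big1 ?addr0 // => k.
    by rewrite -val_eqE /= coefMn coefXn eq_sym => /negbTE ->; rewrite mul0rn.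
  rewrite bin_small // big1 // => k _.
  by rewrite coefMn coefXn gtn_eqF ?mul0rn // (leq_ltn_trans _ ij) // -ltnS.
case: ltnP => [_|/(nth_default 0) ->]; last by rewrite mul0rn.
by rewrite coefZ E mulr_natr.
Qed.

(* By induction on the degree, replacing [Q] by [Q (X + 1) - Q (X)]. *)
Lemma poly_values_generate (R : comUnitRingType) (A : {pred R}) (theta : R) n (Q : {poly R}) :
  (forall a b, a \in A -> b \in A -> a - b \in A) ->
  (forall k, (0 < k <= n.+1)%N -> k%:R \is a @GRing.unit R) ->
  (size Q <= n.+2)%N -> Q`_n.+1 \is a GRing.unit ->
  (forall b, Q.[b] * theta \in A) -> forall r, r * theta \in A.
Proof.
move=> A_subr; elim: n Q => [|n IHn] Q kU sQ Qn QA r.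
  have E x : Q.[x] = Q`_0 + Q`_1 * x.
    by rewrite (horner_coef_wide _ sQ) !big_ord_recr big_ord0 /= expr0 expr1 mulr1 add0r.
  suff -> : r = Q.[r / Q`_1] - Q.[0] by rewrite mulrBl A_subr.
  by rewrite !E mulr0 addr0 mulrC divrK // addrC addKr.
apply: (IHn (Q \Po ('X + 1) - Q)) => [k /andP[k0 kn]|||b].
- by rewrite kU // k0 leqW.
- apply/leq_sizeP => j hj; rewrite coefB (coef_comp_polyXD1 _ sQ) 2!big_ord_recr /=.
  rewrite big1 ?add0r => [|i _]; last first.
    by rewrite bin_small ?mulr0n // (leq_trans (ltn_ord i) (ltnW hj)).
  rewrite (@bin_small n.+1) // mulr0n add0r.
  move: hj; rewrite leq_eqVlt => /orP[/eqP <-|hj]; first by rewrite binn subrr.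
  by rewrite bin_small // mulr0n nth_default ?subrr // (leq_trans sQ).
(* The new leading coefficient is the old one times [n.+2], hence a unit. *)
- rewrite coefB (coef_comp_polyXD1 _ sQ) 2!big_ord_recr /=.
  rewrite big1 ?add0r => [|i _]; last by rewrite bin_small ?mulr0n.
  rewrite binn mulr1n binSn addrAC subrr add0r -mulr_natr unitrM Qn kU //.
  by rewrite ltnSn.
by rewrite hornerD hornerN horner_comp !hornerE mulrBl A_subr.
Qed.

(** The polynomial [((X + 1)^p - X^p - 1) / p]. The division is done on natural numbers, as [p] may
    be a zero divisor in [R]; for prime [p] it sends the constant coefficient 1 to 0. *)
Definition frobenius_defect (R : comNzRingType) p : {poly R} :=
  \poly_(i < p) ('C(p, i) %/ p)%:R.

Lemma frobenius_defectE (R : comNzRingType) p (b : R) : prime p ->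
  p%:R * (frobenius_defect R p).[b] = (b + 1) ^+ p - b ^+ p - 1.
Proof.
case: p => // p pr; rewrite horner_poly mulr_sumr exprD1n.
rewrite [in RHS]big_ord_recr big_ord_recl /= binn bin0 expr0 mulr1n.
rewrite big_ord_recl bin0 divn_small ?prime_gt1 // mul0r mulr0 add0r.
rewrite mulr1n addrK addrAC subrr add0r; apply: eq_bigr => i _.
rewrite mulrA -natrM mulnC divnK ?mulr_natl //; apply: prime_dvd_bin => //.
by rewrite /= ltnS ltn_ord.
Qed.

(** * Counting in finite fields and finite additive groups *)

Lemma natr_card_finField (F : finFieldType) : #|F|%:R = 0 :> F.
Proof.
have /esym/eqP : \sum_(x : F) (x + 1) = \sum_(x : F) x.
  by rewrite [RHS](reindex_inj (addIr 1)).
by rewrite big_split /= -subr_eq0 opprD addNKr oppr_eq0 sumr_const => /eqP.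
Qed.

Lemma card_neq0_finField (F : finFieldType) : #|F| = #|[pred x : F | x != 0]|.+1.
Proof. by rewrite (cardD1 0) inE add1n; congr _.+1; apply: eq_card => x; rewrite !inE andbT. Qed.

(** By counting, [B] meets [z - B], so [z] is a sum of two elements of [B]. *)
Lemma additive_majority (F : finZmodType) (B : {set F}) :
  (forall x y, x \in B -> y \in B -> x - y \in B) -> (#|F| < 2 * #|B|)%N ->
  forall z, z \in B.
Proof.
move=> BB ltFB z.
have [b bB zbB] : exists2 b, b \in B & z - b \in B.
  apply/exists_inP; apply: contraLR ltFB => /exists_inPn nB.
  rewrite -leqNgt mul2n -addnn.
  have dj : [disjoint B & [set z - b | b in B]].
    rewrite disjoint_sym; apply/pred0P => y /=; apply/negP => /andP[/imsetP[b bB ->]].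
    exact/negP/nB.
  have -> : (#|B| + #|B| = #|B :|: [set (z - b)%R | b in B]|)%N.
    by rewrite cardsU disjoint_setI0 // cards0 subn0 card_imset //; apply: subrI.
  exact: max_card.
have B0 : 0 \in B by rewrite -(subrr b) BB.
by rewrite -(subrK b z) -[b in _ + b]opprK BB // -sub0r BB.
Qed.

(** * Difference relations with values in a subgroup of the socle *)

Section Socle.
Variables (R : finComUnitRingType) (F : finFieldType) (pi : {rmorphism R -> F}).
Hypothesis pi_eq0 : forall x, (pi x == 0) = (x \isn't a GRing.unit).
(* [tc] is the Teichmueller section of [pi], with image [T :|: [set 0]]. *)
Variable tc : F -> R.
Hypothesis tcK : cancel tc pi.
Hypotheses (tc0 : tc 0 = 0) (tc1 : tc 1 = 1) (tcM : {morph tc : x y / x * y}).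

Definition socle (s : R) : bool :=
  (pi s == 0) && [forall x, (pi x == 0) ==> (s * x == 0)].

Lemma socle_pi s : socle s -> pi s = 0.
Proof. by case/andP=> /eqP. Qed.

Lemma socle_mul0 s x : socle s -> pi x = 0 -> s * x = 0.
Proof. by case/andP=> _ /forallP /(_ x) /implyP H px; apply/eqP/H/eqP. Qed.

Lemma socleP s : pi s = 0 -> (forall x, pi x = 0 -> s * x = 0) -> socle s.
Proof.
by move=> ps H; apply/andP; split; [apply/eqP|apply/forallP=> x; apply/implyP=> /eqP /H ->].
Qed.

Lemma socle_eq s x y : socle s -> pi x = pi y -> s * x = s * y.
Proof.
move=> ss e; apply/eqP; rewrite -subr_eq0 -mulrBr; apply/eqP.
by apply: socle_mul0; rewrite // rmorphB /= e subrr.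
Qed.

(** The socle is thus a vector space over [F] with scalars acting through [tc], although [tc] need
    not be additive. *)
Lemma socleE s x : socle s -> s * x = s * tc (pi x).
Proof. by move=> ss; apply: socle_eq; rewrite ?tcK. Qed.

Lemma socle0 : socle 0.
Proof. by apply: socleP => [|x _]; rewrite ?rmorph0 ?mul0r. Qed.

Lemma socleB s t : socle s -> socle t -> socle (s - t).
Proof.
move=> hs ht; apply: socleP => [|x px]; first by rewrite rmorphB /= !socle_pi ?subrr.
by rewrite mulrBl !socle_mul0 ?subrr.
Qed.

Lemma socleN s : socle s -> socle (- s).
Proof. by rewrite -sub0r; apply: socleB; apply: socle0. Qed.

Lemma socleD s t : socle s -> socle t -> socle (s + t).
Proof. by move=> hs ht; rewrite -[t]opprK socleB ?socleN. Qed.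

Lemma socleM r s : socle s -> socle (r * s).
Proof.
move=> hs; apply: socleP => [|x px]; first by rewrite rmorphM /= (socle_pi hs) mulr0.
by rewrite -mulrA (socle_mul0 hs px) mulr0.
Qed.

Lemma socleMr r s : socle s -> socle (s * r).
Proof. by rewrite mulrC; apply: socleM. Qed.

Lemma unit_pi x : pi x != 0 -> x \is a GRing.unit.
Proof. by rewrite pi_eq0 negbK. Qed.

Lemma unit_tc x : x != 0 -> tc x \is a GRing.unit.
Proof. by move=> x0; apply: unit_pi; rewrite tcK. Qed.

Lemma tc_inv x : x != 0 -> tc x^-1 = (tc x)^-1.
Proof. by move=> x0; apply: (mulrI (unit_tc x0)); rewrite -tcM divff // tc1 mulrV ?unit_tc. Qed.

Lemma socle_tcB s x y : socle s -> s * tc (x - y) = s * tc x - s * tc y.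
Proof. by move=> hs; rewrite -mulrBr [RHS]socleE // rmorphB /= !tcK. Qed.

Lemma sumr_card_unit s : socle s -> \sum_(x : F | x != 0) s = - s.
Proof.
move=> hs.
rewrite sumr_const; apply: (addrI s); rewrite subrr -mulrS.
rewrite -card_neq0_finField.
by rewrite -mulr_natr socle_mul0 // rmorph_nat natr_card_finField.
Qed.

(* [A] is the set of [a] in [I0] with [1 + a] in [K]. *)
Variable A : {set R}.
Hypotheses (A_socle : forall a, a \in A -> socle a) (A_zero : 0 \in A)
  (A_subr : forall a b, a \in A -> b \in A -> a - b \in A)
  (A_pure : forall s, (forall r, r * s \in A) -> s = 0).

Lemma A_oppr a : a \in A -> - a \in A.
Proof. by rewrite -sub0r; apply: A_subr. Qed.

Lemma A_addr a b : a \in A -> b \in A -> a + b \in A.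
Proof. by move=> ha hb; rewrite -[b]opprK A_subr ?A_oppr. Qed.

Lemma A_sum (I : Type) (r : seq I) (P : pred I) (f : I -> R) :
  (forall i, P i -> f i \in A) -> \sum_(i <- r | P i) f i \in A.
Proof. by move=> H; elim/big_rec: _ => // i x Pi xA; rewrite A_addr ?H. Qed.

(* Averaging [f] over the powers of some [r] outside of the stabiliser of [f]
   enlarges the stabiliser, so the average is constant by induction; hence
   [(f x - f y) * tc (v r)] is in [A] for all such [r].  They make up at least half
   of [F^*], so with 0 the [z] such that [(f x - f y) * tc z] is in [A] are more
   than half of [F]. *)
Lemma directions_const (v : F -> F) (f : F -> R) :
  {in [pred r : F | (r != 0) && (r != 1)] &, injective v} ->
  (forall r, r != 0 -> r != 1 -> v r != 0) ->
  (forall x, socle (f x)) ->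
  (forall r x, r != 0 -> r != 1 -> x != 0 -> (f (r * x) - f x) * tc (v r) \in A) ->
  forall x y, x != 0 -> y != 0 -> f x = f y.
Proof.
move=> v_inj v0.
pose stab f := [set r : F | (r != 0) && [forall x, (x != 0) ==> (f (r * x) == f x :> R)]].
have stabP f1 r : reflect (r != 0 /\ forall x, x != 0 -> f1 (r * x) = f1 x) (r \in stab f1).
  rewrite inE; apply: (iffP andP) => -[-> H]; split=> //.
    by move=> x x0; apply/eqP; apply: (implyP (forallP H x)).
  by apply/forallP=> x; apply/implyP=> x0; rewrite H.
move: {2}_.+1 (ltnSn (#|F| - #|stab f|)) => n; elim: n f => // n IHn f ltn f_soc f_dir x y x0 y0.
have [fr|] := boolP [forall r, (r != 0) ==> (r \in stab f)].
  have r0 : y / x != 0 by rewrite mulf_neq0 ?invr_eq0.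
  by have /stabP[_ /(_ x x0)] := implyP (forallP fr _) r0; rewrite divfK.
rewrite negb_forall => /existsP[r1]; rewrite negb_imply => /andP[r1_0 r1N].
pose d := f x - f y.
pose B := [set z | d * tc z \in A].
have d_soc : socle d by apply: socleB.
have BB z z' : z \in B -> z' \in B -> z - z' \in B.
  by rewrite !inE => hz hz'; rewrite socle_tcB // A_subr.
have vB r : r != 0 -> r \notin stab f -> v r \in B.
  move=> r0 rN; rewrite inE.
  have r_1 : r != 1 by apply: contraNneq rN => ->; apply/stabP; split=> [|z _]; rewrite ?oner_eq0 ?mul1r.
  (* As [r ^+ #|F|.-1 = 1], multiplying [z] by [r] permutes the terms: [r] stabilises [H] but not
     [f]. *)
  pose H z := \sum_(j < #|F|.-1) f (r ^+ j * z).
  have rI j : r ^+ j != 0 by rewrite expf_neq0.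
  have fj j z : z != 0 -> (f (r ^+ j * z) - f z) * tc (v r) \in A.
    move=> z0; elim: j => [|j IHj]; first by rewrite expr0 mul1r subrr mul0r.
    rewrite exprS -mulrA -[f _](subrK (f (r ^+ j * z))) -addrA mulrDl A_addr //.
    by apply: f_dir => //; rewrite mulf_neq0.
  have HE : H x = H y.
    have H_dir r' z : r' != 0 -> r' != 1 -> z != 0 -> (H (r' * z) - H z) * tc (v r') \in A.
      move=> r'0 r'1 z0; rewrite -sumrB mulr_suml; apply: A_sum => j _.
      by rewrite mulrCA; apply: f_dir => //; rewrite mulf_neq0.
    have H_soc z : socle (H z).
      by rewrite /H; elim/big_rec: _ => [|i a _ ha]; [exact: socle0|exact: socleD].
    apply: IHn => //.
    rewrite ltnS in ltn; apply: leq_trans ltn; apply: ltn_sub2l.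
      rewrite card_neq0_finField ltnS.
      by apply: subset_leq_card; apply/subsetP=> z /stabP[].
    apply: proper_card; apply/properP; split.
      apply/subsetP=> z /stabP[z0 hz]; apply/stabP; split=> // t t0.
      by apply: eq_bigr => j _; rewrite mulrCA hz // mulf_neq0.
    exists r => //; apply/stabP; split=> // t t0.
    rewrite /H; have [m Em] : exists m, #|F|.-1 = m.+1.
      by exists #|F|.-2; rewrite prednK // -subn1 subn_gt0 finNzRing_gt1.
    have rm : r ^+ m.+1 = 1.
      apply: (mulfI r0); rewrite -exprS -Em prednK ?expf_card ?mulr1 //.
      by apply: ltnW; apply: finNzRing_gt1.
    rewrite Em big_ord_recr big_ord_recl /= expr0 mul1r addrC; congr (_ + _).
      by rewrite mulrA -exprSr rm mul1r.
    by apply: eq_bigr => j _; rewrite /bump /= add1n exprSr mulrA.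
  (* Subtracting [f z] from each of the [#|F|.-1] terms amounts to adding [f z], since [#|F|] kills
     the socle. *)
  have key z : z != 0 -> (f z + H z) * tc (v r) \in A.
    move=> z0.
    have -> : f z + H z = \sum_(j < #|F|.-1) (f (r ^+ j * z) - f z).
      rewrite sumrB addrC; congr (_ + _).
      rewrite sumr_const card_ord -[LHS]opprK -(sumr_card_unit (f_soc z)) sumr_const; congr (- (_ *+ _)).
      by rewrite card_neq0_finField.
    by rewrite mulr_suml; apply: A_sum => j _; apply: fj.
  have -> : d = f x + H x - (f y + H y) by rewrite HE /d; ring.
  by rewrite mulrBl A_subr ?key.
have Bfull z : z \in B.
  apply: additive_majority => {z} //.
  pose M := [set r : F | r != 0] :\: stab f.
  (* Multiplication by [r1], which is outside the stabiliser, moves the stabiliser into its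
     complement. *)
  have cM : (#|stab f| <= #|M|)%N.
    rewrite -(card_imset (mem (stab f)) (mulfI r1_0)); apply: subset_leq_card.
    apply/subsetP=> _ /imsetP[z /stabP[z0 hz] ->]; rewrite !inE mulf_neq0 // andbT.
    apply: contra r1N => /forallP H; apply/stabP; split=> // t t0.
    have tz : t / z != 0 by rewrite mulf_neq0 ?invr_eq0.
    have /eqP := implyP (H (t / z)) tz; rewrite mulrAC -mulrA divfK // => ->.
    by rewrite -hz // mulrC divfK.
  have MB : (#|M|.+1 <= #|B|)%N.
    have inM r : r \in M -> [/\ r != 0, r != 1 & r \notin stab f].
      rewrite in_setD => /andP[rN]; rewrite inE => r0; split=> //.
      by apply: contraNneq rN => ->; apply/stabP; split=> [|t _]; rewrite ?oner_eq0 ?mul1r.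
    have -> : (#|M|.+1 = #|0%R |: [set v r | r in M]|)%N.
      rewrite cardsU1 card_in_imset; last first.
        by move=> r r' /inM[? ? _] /inM[? ? _]; apply: v_inj; apply/andP.
      case: imsetP => // -[r /inM[r0 r'1 _]] /esym/eqP; by rewrite (negbTE (v0 _ r0 r'1)).
    apply: subset_leq_card; apply/subsetP=> z; rewrite in_setU1 => /orP[/eqP ->|].
      by rewrite inE tc0 mulr0.
    by case/imsetP=> r /inM[r0 _ rN] ->; apply: vB.
  have cF : (#|F| = #|stab f| + #|M| + 1)%N.
    have sub : stab f \subset [set r : F | r != 0] by apply/subsetP=> z; rewrite !inE => /andP[].
    rewrite cardsD (setIidPr sub) subnKC ?subset_leq_card // addn1.
    by rewrite card_neq0_finField; congr _.+1; apply: eq_card => t; rewrite !inE.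
  rewrite cF addn1 mul2n -addnn; apply: leq_trans (leq_add MB MB).
  by rewrite addSn addnS !ltnS leq_add2r.
(* All multiples of [d] lie in [A], so purity gives [d = 0]. *)
apply/eqP; rewrite -subr_eq0 -/d; apply/eqP; apply: A_pure => r.
by have := Bfull (pi r); rewrite inE -socleE // mulrC.
Qed.

(** * Maps multiplying differences by elements of K *)

Variable g : R -> R.
Hypotheses (g_inj : injective g) (g0 : g 0 = 0) (g1 : g 1 = 1).
Hypothesis g_rel : forall x y, exists c a,
  [/\ c != 0, a \in A & g y - g x = (y - x) * tc c * (1 + a)].

Lemma pi_add1A a : a \in A -> pi (1 + a) = 1.
Proof. by move=> /A_socle/socle_pi pa; rewrite rmorphD rmorph1 /= pa addr0. Qed.

Lemma pi_g_eq x y : (pi (g x) == pi (g y)) = (pi x == pi y).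
Proof.
have [c [a [c0 aA E]]] := g_rel x y.
rewrite eq_sym [RHS]eq_sym -[LHS]subr_eq0 -[RHS]subr_eq0 -!rmorphB /= E.
rewrite !rmorphM /= tcK pi_add1A // mulr1.
by rewrite mulf_eq0 (negbTE c0) orbF.
Qed.

Definition g_res (u : F) : F := pi (g (tc u)).

Lemma pi_g x : pi (g x) = g_res (pi x).
Proof. by apply/eqP; rewrite pi_g_eq tcK. Qed.

Lemma g_res0 : g_res 0 = 0.
Proof. by rewrite /g_res tc0 g0 rmorph0. Qed.

Lemma g_res1 : g_res 1 = 1.
Proof. by rewrite /g_res tc1 g1 rmorph1. Qed.

Lemma g_res_inj : injective g_res.
Proof. by move=> u v /eqP; rewrite /g_res pi_g_eq !tcK => /eqP. Qed.

(** The residue of the multiplier of [y - x], when [x] and [y] differ modulo the radical. *)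
Definition slope x y : F := (pi (g y) - pi (g x)) / (pi y - pi x).

Lemma slopeC x y : slope x y = slope y x.
Proof. by rewrite /slope -[pi x - _]opprB -[pi (g x) - _]opprB invrN mulrNN. Qed.

Lemma g_slope x y : pi x != pi y ->
  exists2 a, a \in A & g y - g x = (y - x) * tc (slope x y) * (1 + a).
Proof.
move=> xy; have [c [a [c0 aA E]]] := g_rel x y; exists a => //.
have d0 : pi y - pi x != 0 by rewrite subr_eq0 eq_sym.
suff -> : slope x y = c by [].
rewrite /slope -!rmorphB /= E !rmorphM /= tcK pi_add1A //.
by rewrite mulr1 rmorphB mulrAC divff // mul1r.
Qed.

(** The chords from [x] to [y] and to [y + s] have the same slope, which only depends on residues;
    subtract them. *)
Lemma g_add_rad x y s : pi s = 0 -> pi x != pi y ->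
  exists a b, [/\ a \in A, b \in A &
    g (y + s) - g y = tc (slope x y) * (s * (1 + b) + (y - x) * a)].
Proof.
move=> ps xy.
have pys : pi (y + s) = pi y by rewrite rmorphD /= ps addr0.
have sl : slope x (y + s) = slope x y by rewrite /slope (pi_g (y + s)) pys -pi_g.
have [a aA Ea] := g_slope xy.
have [b bA] : exists2 b, b \in A & g (y + s) - g x = (y + s - x) * tc (slope x y) * (1 + b).
  by rewrite -sl; apply: g_slope; rewrite pys.
move=> Eb; exists (b - a), b; split=> //; first exact: A_subr.
by rewrite -[LHS](subrKA (g x)) -[g x - _]opprB Ea Eb; ring.
Qed.

Lemma g_add_socle x y s : socle s -> pi x != pi y ->
  exists2 a, a \in A & g (y + s) - g y = tc (slope x y) * (s + (y - x) * a).
Proof.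
move=> hs xy; have [a [b [aA bA ->]]] := g_add_rad (socle_pi hs) xy.
exists a => //; congr (_ * (_ + _)).
by rewrite -[RHS]mulr1; apply: socle_eq; rewrite ?rmorph1 ?pi_add1A.
Qed.

Lemma pi_neq_sub1 y : pi (y - 1) != pi y.
Proof. by rewrite rmorphB rmorph1 -subr_eq0 addrAC subrr sub0r oppr_eq0 oner_eq0. Qed.

Lemma g_shift_socle y s : socle s -> socle (g (y + s) - g y).
Proof.
move=> hs; have [a /A_socle aA ->] := g_add_socle hs (pi_neq_sub1 y).
by rewrite socleM // socleD // socleM.
Qed.

(** For [x = y - tc u^-1] the slope times the scaling factor is [u], which cancels the factor
    [y - x] of the error in [A]. For [u = 0] both terms vanish. *)
Lemma g_shift_chord y s u : socle s ->
  (g (y + s) - g y) * tc (g_res (pi y) - g_res (pi y - u^-1))^-1 - s * tc u \in A.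
Proof.
move=> hs; have [->|u0] := eqVneq u 0.
  by rewrite invr0 subr0 subrr invr0 tc0 !mulr0 subrr.
pose x := y - tc u^-1.
have px : pi x = pi y - u^-1 by rewrite rmorphB /= tcK.
have xy : pi x != pi y by rewrite px -subr_eq0 addrAC subrr sub0r oppr_eq0 invr_eq0.
have [a aA ->] := g_add_socle hs xy; have haA := A_socle aA.
have gd0 : g_res (pi y) - g_res (pi y - u^-1) != 0.
  by rewrite subr_eq0 (inj_eq g_res_inj) -px eq_sym.
have E : slope x y * (g_res (pi y) - g_res (pi y - u^-1))^-1 = u.
  have -> : slope x y = (g_res (pi y) - g_res (pi y - u^-1)) * u.
    rewrite /slope !pi_g px.
    have -> : pi y - (pi y - u^-1) = u^-1 by rewrite opprB addrCA subrr addr0.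
    by rewrite invrK.
  by rewrite mulrAC divff ?mul1r.
rewrite mulrC mulrA -tcM [_^-1 * _]mulrC E mulrDr /x opprB addrCA subrr addr0.
by rewrite mulrA -tcM divff // tc1 mul1r mulrC addrC addKr.
Qed.

Definition socle_set : {set R} := [set s | socle s].

(** An injective self-map of the finite socle is onto. *)
Lemma g_shift_surj y w : socle w -> exists2 s, socle s & g (y + s) - g y = w.
Proof.
pose f s := g (y + s) - g y.
have f_inj : injective f by move=> s t /addIr /g_inj /addrI.
have E : f @: socle_set = socle_set.
  apply/eqP; rewrite eqEcard card_imset // leqnn andbT.
  by apply/subsetP=> _ /imsetP[s + ->]; rewrite !inE => hs; apply: g_shift_socle.
move=> hw; have : w \in f @: socle_set by rewrite E inE.
by case/imsetP=> s; rewrite inE => hs ->; exists s.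
Qed.

(** With [d] the defect of additivity, combining [g_shift_chord] at [u + v], [u] and [v] cancels the
    terms in [s] and leaves [w * tc d] in [A] for every socle element [w]. If [d] were nonzero, [A]
    would contain the whole socle, an ideal. *)
Lemma g_res_chord : (exists2 w, socle w & w != 0) -> forall y u v,
  (g_res y - g_res (y - (u + v)^-1))^-1
    = (g_res y - g_res (y - u^-1))^-1 + (g_res y - g_res (y - v^-1))^-1.
Proof.
case=> w0 hw0 w0_neq0 y u v.
pose k z := (g_res y - g_res (y - z^-1))^-1.
apply/eqP; rewrite -subr_eq0; apply: contraNT w0_neq0 => d0; apply/eqP.
pose d := k (u + v) - (k u + k v).
have inA w : socle w -> w * tc d \in A.
  case/(g_shift_surj (tc y)) => s hs Es.
  have H z : w * tc (k z) - s * tc z \in A.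
    by have := g_shift_chord (tc y) z hs; rewrite tcK Es.
  have hw : socle w by rewrite -Es; apply: g_shift_socle.
  have tcD t a b : socle t -> t * tc (a + b) = t * tc a + t * tc b.
    by move=> ht; rewrite -mulrDr [RHS]socleE // rmorphD /= !tcK.
  have := A_subr (H (u + v)) (A_addr (H u) (H v)).
  rewrite /d socle_tcB // !tcD //; congr (_ \in A); ring.
apply: A_pure => r; have -> : r * w0 = r * tc d^-1 * w0 * tc d.
  by rewrite -!mulrA [w0 * _]mulrC !mulrA -(mulrA r) -tcM mulVf // tc1 mulr1.
by apply: inA; apply: socleM.
Qed.

(** * When the residue map is a field morphism *)

Section ResidueMorphism.
Variable hm : {rmorphism F -> F}.
Hypothesis g_resE : g_res =1 hm.
(** The difference has residue 0, so this holds if the whole radical is the socle; if [hm] is the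
    identity, the difference is 0. These are the two cases of use. *)
Hypothesis hm_defect : forall r, r != 1 ->
  socle ((tc r - 1) * tc ((hm r - 1) / (r - 1)) - (tc (hm r) - 1)).

Lemma hm_surj v : exists u, v = hm u.
Proof.
have hm_inj : injective hm by apply: fmorph_inj.
by have [k _ kK] := injF_bij hm_inj; exists (k v); rewrite kK.
Qed.

Lemma g_shift_hm y s z : socle s -> (g (y + s) - g y) * tc (hm z) - s * tc z \in A.
Proof.
move=> hs; have := g_shift_chord y z hs.
by rewrite !g_resE -rmorphB /= subKr fmorphV invrK.
Qed.

Lemma socle_hm_eq0 s : socle s -> (forall z, s * tc (hm z) \in A) -> s = 0.
Proof.
move=> hs H; apply: A_pure => r; have [z Ez] := hm_surj (pi r).
by rewrite mulrC socleE // Ez.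
Qed.

Lemma g_socle s : socle s -> socle (g s).
Proof. by move=> hs; have := g_shift_socle 0 hs; rewrite add0r g0 subr0. Qed.

Lemma g_socle_hm s z : socle s -> g s * tc (hm z) - s * tc z \in A.
Proof. by move=> hs; have := g_shift_hm 0 z hs; rewrite add0r g0 subr0. Qed.

(** The increments [g (y + s) - g y] and [g s] satisfy the same congruences modulo [A] for all [z],
    and purity leaves at most one solution. *)
Lemma g_addr_socle y s : socle s -> g (y + s) = g y + g s.
Proof.
move=> hs; apply/eqP; rewrite -subr_eq0 opprD addrA; apply/eqP.
apply: socle_hm_eq0 => [|z]; first by rewrite socleB ?g_socle ?g_shift_socle.
have := A_subr (g_shift_hm y z hs) (g_socle_hm z hs).
by congr (_ \in A); ring.
Qed.

Lemma g_mul_socle r s : socle s -> g (r * s) = tc (hm (pi r)) * g s.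
Proof.
move=> hs; have hrs := socleM r hs; apply/eqP; rewrite -subr_eq0; apply/eqP.
apply: socle_hm_eq0 => [|z]; first by rewrite socleB ?socleM ?g_socle.
have := A_subr (g_socle_hm z hrs) (g_socle_hm (pi r * z) hs).
rewrite rmorphM !tcM /= -(mulrC s r) (socleE r hs); congr (_ \in A); ring.
Qed.

Lemma g_teichmuller u : g (tc u) = tc (hm u).
Proof.
have [->|u0] := eqVneq u 0; first by rewrite rmorph0 tc0 g0.
pose f x := if x == 0 then 0 else g (tc x) / tc (hm x) - 1.
have hm0 x : x != 0 -> hm x != 0 by rewrite fmorph_eq0.
have fE x : x != 0 -> g (tc x) = tc (hm x) * (1 + f x).
  by move=> x0; rewrite /f (negbTE x0) [1 + _]addrC subrK mulrC divrK ?unit_tc ?hm0.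
have fA x : f x \in A.
  have [->|x0] := eqVneq x 0; first by rewrite /f eqxx.
  have [c [a [c0 aA]]] := g_rel 0 (tc x); rewrite g0 !subr0 => E.
  have Ec : hm x = x * c.
    by rewrite -g_resE /g_res E !rmorphM /= !tcK pi_add1A ?mulr1.
  suff -> : f x = a by [].
  apply: (addrI 1); apply: (mulrI (unit_tc (hm0 _ x0))).
  by rewrite -fE // E Ec tcM.
have f_soc x : socle (f x) by apply/A_socle/fA.
(* The part of the chord relation between [tc x] and [tc (r * x)] that, after division by
   [tc (hm x)], does not depend on [x]. *)
pose e r := (tc r - 1) * tc ((hm r - 1) / (r - 1)) - (tc (hm r) - 1).
have hm1 r : r != 1 -> hm r - 1 != 0 by move=> r1; rewrite -(rmorph1 hm) -rmorphB fmorph_eq0 subr_eq0.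
have f_rel r x : r != 0 -> r != 1 -> x != 0 ->
    (f (r * x) - f x - e r) * tc (hm r - 1)^-1 \in A.
  move=> r0 r1 x0; have rx0 : r * x != 0 by rewrite mulf_neq0.
  have r10 : r - 1 != 0 by rewrite subr_eq0.
  have tcrx : pi (tc x) != pi (tc (r * x)).
    by rewrite !tcK -[x in x == _]mul1r (inj_eq (mulIf x0)) eq_sym.
  have [a aA] := g_slope tcrx.
  have -> : slope (tc x) (tc (r * x)) = (hm r - 1) / (r - 1) * (hm x / x).
    rewrite /slope !tcK !pi_g !tcK !g_resE rmorphM /=; field.
    by rewrite r10 x0 -[X in r * x - X]mul1r -mulrBl mulf_neq0.
  rewrite !fE // rmorphM !tcM /= => E.
  have {}E : tc (hm r) * (1 + f (r * x)) - (1 + f x)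
      = (tc r - 1) * tc ((hm r - 1) / (r - 1)) * (1 + a).
    apply: (mulrI (unit_tc (hm0 _ x0))); rewrite mulrBr mulrA [tc (hm x) * _]mulrC E.
    rewrite (tc_inv x0) tcM; have := mulrV (unit_tc x0) => Ex.
    transitivity (tc x * (tc x)^-1 *
      (tc (hm x) * ((tc r - 1) * (tc (hm r - 1) * tc (r - 1)^-1) * (1 + a)))); first by ring.
    by rewrite Ex mul1r.
  have {}E : f (r * x) - f x - e r
      = (tc r - 1) * tc ((hm r - 1) / (r - 1)) * a - (tc (hm r) - 1) * f (r * x).
    have -> : f (r * x) - f x - e r = tc (hm r) * (1 + f (r * x)) - (1 + f x)
      - (tc (hm r) - 1) * f (r * x) - (tc (hm r) - 1) - e r by ring.
    by rewrite E /e; ring.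
  (* Scaled by [tc (hm r - 1)^-1], both coefficients are 1 modulo the radical, so they act trivially
     on [A]. *)
  have pd : pi ((tc r - 1) * tc ((hm r - 1) / (r - 1)) * tc (hm r - 1)^-1) = 1.
    by rewrite !rmorphM rmorphB rmorph1 /= !tcK; field; rewrite r10 hm1.
  have pd' : pi ((tc (hm r) - 1) * tc (hm r - 1)^-1) = 1.
    by rewrite rmorphM rmorphB rmorph1 /= !tcK divff // hm1.
  have unit_res c d w : socle c -> pi (d * w) = 1 -> d * c * w = c.
    move=> hc pdw; rewrite mulrAC mulrC -[RHS]mulr1; apply: socle_eq => //.
    by rewrite pdw rmorph1.
  by rewrite E mulrBl (unit_res a) ?A_socle // (unit_res (f _)) // A_subr.
(* Summing [f_rel] over nonzero [x], the values of [f] cancel and [#|F|.-1] copies of [- e r] add up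
   to [e r]. *)
have e_A r : r != 0 -> r != 1 -> e r * tc (hm r - 1)^-1 \in A.
  move=> r0 r1; have he : socle (e r) by apply: hm_defect.
  have -> : e r * tc (hm r - 1)^-1
      = \sum_(x | x != 0) (f (r * x) - f x - e r) * tc (hm r - 1)^-1.
    rewrite -mulr_suml 2!sumrB; congr (_ * _).
    have -> : \sum_(x | x != 0) f (r * x) = \sum_(x | x != 0) f x.
      rewrite [RHS](reindex_inj (mulfI r0)); apply: eq_bigl => x.
      by rewrite mulf_eq0 (negbTE r0).
    by rewrite subrr sub0r (sumr_card_unit he) opprK.
  by apply: A_sum => x x0; apply: f_rel.
have f_const x y : x != 0 -> y != 0 -> f x = f y.
  apply: (@directions_const (fun r => (hm r - 1)^-1) f) => //.
  - by move=> r s _ _ /invr_inj /addIr /fmorph_inj.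
  - by move=> r r0 r1; rewrite invr_eq0 hm1.
  move=> r z r0 r1 z0; have := A_addr (f_rel r z r0 r1 z0) (e_A r r0 r1).
  by rewrite -mulrDl subrK.
have f1 : f 1 = 0 by rewrite /f oner_eq0 rmorph1 tc1 g1 divr1 subrr.
by rewrite fE // (f_const u 1) ?oner_eq0 // f1 addr0 mulr1.
Qed.

(** * When the radical equals the socle *)

Section RadicalSocle.
Hypothesis rad_socle : forall s, pi s = 0 -> socle s.

Lemma g_split u s : pi s = 0 -> g (tc u + s) = tc (hm u) + g s.
Proof. by move=> ps; rewrite g_addr_socle ?g_teichmuller ?rad_socle. Qed.

Lemma tc_split x : exists u s, pi s = 0 /\ x = tc u + s.
Proof.
exists (pi x), (x - tc (pi x)); split; last by rewrite addrC subrK.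
by rewrite rmorphB /= tcK subrr.
Qed.

(** Expand both factors as [tc u + s]: products of two socle elements vanish, before and after
    applying [g]. *)
Lemma g_mulr x y : g (x * y) = g x * g y.
Proof.
have [u [s [ps ->]]] := tc_split x; have [v [t [pt ->]]] := tc_split y.
have [hs ht] := (rad_socle ps, rad_socle pt).
have -> : (tc u + s) * (tc v + t) = tc (u * v) + (tc u * t + tc v * s).
  by rewrite tcM mulrDr !mulrDl (socle_mul0 hs pt) addr0; ring.
have gs0 : g s * g t = 0 by apply: socle_mul0; [exact: g_socle | exact/socle_pi/g_socle].
rewrite g_split; last by rewrite rmorphD !rmorphM /= ps pt !mulr0 addr0.
rewrite (g_addr_socle _ (socleM _ hs)) !g_mul_socle // !tcK !g_split //.
rewrite rmorphM tcM mulrDr !mulrDl gs0 addr0 /=; ring.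
Qed.

Lemma g_exp x n : g (x ^+ n) = g x ^+ n.
Proof. by elim: n => [|n IHn]; rewrite ?expr0 ?g1 // !exprS g_mulr IHn. Qed.

Lemma tc_exp u n : tc (u ^+ n) = tc u ^+ n.
Proof. by elim: n => [|n IHn]; rewrite ?expr0 ?tc1 // !exprS tcM IHn. Qed.

(** The difference [x - y] is in the socle, and its cofactor in [x ^+ p - y ^+ p] has residue
    [p * pi y ^+ p.-1], which is 0. *)
Lemma pi_eq_expr p x y : p \in [pchar F] -> pi x = pi y -> x ^+ p = y ^+ p.
Proof.
move=> pF xy; apply/eqP; rewrite -subr_eq0 subrXX; apply/eqP.
apply: socle_mul0; first by apply: rad_socle; rewrite rmorphB /= xy subrr.
rewrite rmorph_sum /= (eq_bigr (fun=> pi y ^+ p.-1)) => [|i _]; last first.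
  rewrite rmorphM !rmorphXn /= xy -exprD subnK //.
  by case: p i {pF} => [[] //|p i]; rewrite -ltnS.
by rewrite sumr_const card_ord -mulr_natr (pcharf0 pF) mulr0.
Qed.

Lemma g_addr1 x : g (x + 1) = g x + 1.
Proof.
have [p pr pF] := finPcharP F.
pose P := frobenius_defect R p.
have hp : socle p%:R by apply: rad_socle; rewrite rmorph_nat (pcharf0 pF).
pose theta := p%:R - g p%:R.
have hth : socle theta by rewrite socleB ?g_socle.
have key a : g (a ^+ p + 1) - g (a ^+ p) - 1 = P.[g a] * theta.
  have Ea b : (b + 1) ^+ p = b ^+ p + 1 + p%:R * P.[b].
    by rewrite frobenius_defectE //; ring.
  have hP b : socle (p%:R * P.[b]) by apply: socleMr.
  have pgP : pi (g P.[a]) = pi P.[g a].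
    rewrite pi_g g_resE !horner_poly !rmorph_sum /=; apply: eq_bigr => i _.
    by rewrite !rmorphM !rmorphXn !rmorph_nat /= pi_g g_resE.
  (* Here [p]-th powers depend on residues only, and [g] is additive on residues. Expanding both
     sides gives [key]. *)
  have : g (a + 1) ^+ p = (g a + 1) ^+ p.
    apply: pi_eq_expr => //.
    by rewrite pi_g g_resE !rmorphD !rmorph1 /= -g_resE -pi_g.
  rewrite -g_exp Ea (g_addr_socle _ (hP a)) Ea g_mulr (socle_eq (g_socle hp) pgP) => E.
  rewrite -g_exp in E; rewrite /theta mulrBr [P.[g a] * p%:R]mulrC [P.[g a] * g _]mulrC.
  by rewrite -addrA -opprD; apply/eqP; rewrite subr_eq addrAC -subr_eq opprK E; apply/eqP; ring.
have theta0 : theta = 0.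
  have [g' _ gK] := injF_bij g_inj.
  have [n Ep] : exists n, p = n.+2.
    by have p1 := prime_gt1 pr; exists p.-2; rewrite -subn2 -addn2 subnK.
  apply: A_pure; apply: (@poly_values_generate _ (mem A) _ n P) => // [k||| b].
  - move=> /andP[k0 kn]; apply: unit_pi => //.
    by rewrite rmorph_nat -(dvdn_pcharf pF) gtnNdvd // Ep ltnS.
  - by rewrite -Ep; apply: size_poly.
  - by rewrite /P /frobenius_defect coef_poly Ep ltnSn binSn divnn unitr1.
  (* Every [b] is some [g a], and the chord from [a ^+ p] to [a ^+ p + 1] has slope 1, so the left
     side of [key] is in [A]. *)
  rewrite -[b]gK -key; move: (g' b) => a.
  have pa : pi (a ^+ p) != pi (a ^+ p + 1).
    by rewrite rmorphD rmorph1 -subr_eq0 opprD addNKr oppr_eq0 oner_eq0.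
  have [c cA ->] := g_slope pa.
  have -> : slope (a ^+ p) (a ^+ p + 1) = 1.
    rewrite /slope !pi_g !g_resE !rmorphD !rmorph1 /=.
    by rewrite ![_ + 1]addrC !addrK divr1.
  by rewrite tc1 addrAC subrr add0r !mul1r addrC addKr.
have [u [s [ps ->]]] := tc_split x; have hs := rad_socle ps.
(* Frobenius is onto, so [key] reaches every Teichmueller element. *)
have [v Ev] : exists v, u = v ^+ p.
  have fr_inj : injective (pFrobenius_aut pF) by apply: fmorph_inj.
  by have [k _ kK] := injF_bij fr_inj; exists (k u); rewrite -[LHS]kK pFrobenius_autE.
have := key (tc v); rewrite theta0 mulr0 -tc_exp -Ev => /eqP; rewrite subr_eq0 subr_eq => /eqP E.
by rewrite addrAC !(g_addr_socle _ hs) E; ring.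
Qed.

(** If [y] is in the radical, it is a socle element; otherwise factoring out the unit [y] reduces to
    adding 1. *)
Lemma g_addr x y : g (x + y) = g x + g y.
Proof.
have [/eqP py|py] := boolP (pi y == 0); first by rewrite g_addr_socle ?rad_socle.
have uy := unit_pi py.
have -> : x + y = (x / y + 1) * y by rewrite mulrDl divrK ?mul1r.
rewrite g_mulr g_addr1 mulrDl mul1r.
by rewrite -g_mulr divrK.
Qed.
End RadicalSocle.
End ResidueMorphism.

(** * The dichotomy between the identity and a ring morphism *)

Lemma g_id_or_morphism (not_fieldR : exists2 w : R, w != 0 & pi w = 0) :
  (forall x, g x = x) \/ {morph g : x y / x + y} /\ {morph g : x y / x * y}.
Proof.
have [/forallP rs|] := boolP [forall s, (pi s == 0) ==> socle s].
  right; have rad_socle s : pi s = 0 -> socle s.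
    by move/eqP=> ps; apply: (implyP (rs s)).
  have soc_neq0 : exists2 w, socle w & w != 0.
    by case: not_fieldR => w w0 pw; exists w => //; apply: rad_socle.
  have chord := g_res_chord soc_neq0.
  have hD := huaD g_res_inj g_res0 g_res1 chord.
  have hM := huaM g_res_inj g_res0 g_res1 chord.
  have hB : zmod_morphism g_res.
    by move=> u v; rewrite hD (huaN g_res0 chord).
  have hMM : monoid_morphism g_res by split; [exact: g_res1 | exact: hM].
  pose h1 := GRing.isZmodMorphism.Build F F g_res hB.
  pose h2 := GRing.isMonoidMorphism.Build F F g_res hMM.
  pose hm : {rmorphism F -> F} := HB.pack g_res h1 h2.
  have defect r : r != 1 -> socle ((tc r - 1) * tc ((hm r - 1) / (r - 1)) - (tc (hm r) - 1)).
    move=> r1; apply: rad_socle; rewrite !(rmorphB, rmorphM) !rmorph1 /= !tcK.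
    by rewrite mulrC divfK ?subrr // subr_eq0.
  by split=> x y; [apply: (@g_addr hm) | apply: (@g_mulr hm)].
rewrite negb_forall => /existsP[s0]; rewrite negb_imply => /andP[/eqP ps0 ns0]; left.
(* Since [A] kills [s], the chord from [y] to [y + s] multiplies [s] by [tc c]. If some slope at [y]
   differed from [c], a unit multiple of [s] would be in the socle. *)
have c_slope s x y : pi s = 0 -> ~~ socle s -> pi x != pi y ->
    g (y + s) - g y = s * tc (slope x y) /\ forall x', pi x' != pi y -> slope x' y = slope x y.
  move=> ps ns xy.
  have [c [a [c0 aA]]] := g_rel y (y + s); rewrite [y + s]addrC addrK => E.
  have {}E : g (s + y) - g y = s * tc c.
    rewrite E -mulrA mulrDr mulr1 mulrDr mulrCA [s * a]mulrC.
    by rewrite (socle_mul0 (A_socle aA) ps) mulr0 addr0.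
  have all_c x' : pi x' != pi y -> slope x' y = c.
    move=> xy'; have [a' [b [a'A bA]]] := g_add_rad ps xy'.
    rewrite [y + s]addrC E => E'; apply/eqP; apply: contraNT ns => cN.
    have sb : s * b = 0 by rewrite mulrC (socle_mul0 (A_socle bA) ps).
    have ud : tc c - tc (slope x' y) \is a GRing.unit.
      by apply: unit_pi => //; rewrite rmorphB /= !tcK subr_eq0 eq_sym.
    rewrite -(mulrK ud s); apply: socleMr; rewrite mulrBr E' [s * (1 + b)]mulrDr sb addr0 mulr1.
    rewrite mulrDr [tc _ * s]mulrC addrAC subrr add0r.
    by rewrite !socleM // A_socle.
  by rewrite (all_c _ xy) E; split=> // x' /all_c.
have ind y x x' : pi x != pi y -> pi x' != pi y -> slope x y = slope x' y.
  by move=> xy xy'; have [_ ->] := c_slope _ _ _ ps0 ns0 xy'.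
have sl01 : slope 0 1 = 1 by rewrite /slope g0 g1 rmorph0 rmorph1 !subr0 divff ?oner_eq0.
(* Independence of the first argument and symmetry connect every slope to [slope 0 1]. *)
have sl1 x y : pi x != pi y -> slope x y = 1.
  move=> xy; have [y0|y0] := eqVneq (pi y) 0.
    rewrite (ind y x 1) //; last by rewrite y0 rmorph1 oner_eq0.
    rewrite slopeC (ind 1 y 0) // ?y0 ?rmorph0 rmorph1 eq_sym oner_eq0 //.
  rewrite (ind y x 0) //; last by rewrite rmorph0 eq_sym.
  by rewrite slopeC (ind 0 y 1) ?rmorph0 // ?rmorph1 ?oner_eq0 // slopeC.
have g_resE : g_res =1 @idfun F.
  move=> u; have [->|u0] := eqVneq u 0; first exact: g_res0.
  have /sl1 : pi 0 != pi (tc u) by rewrite tcK rmorph0 eq_sym.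
  rewrite /slope tcK g0 rmorph0 !subr0 => E.
  by rewrite /g_res -[LHS](divfK u0) E mul1r.
have defect r : r != 1 -> socle ((tc r - 1) * tc ((r - 1) / (r - 1)) - (tc r - 1)).
  by move=> r1; rewrite divff ?subr_eq0 // tc1 mulr1 subrr socle0.
move=> x; pose s := x - tc (pi x).
have ps : pi s = 0 by rewrite rmorphB /= tcK subrr.
have -> : x = tc (pi x) + s by rewrite addrC subrK.
have gtc := @g_teichmuller idfun g_resE defect.
have [hs|ns] := boolP (socle s).
  rewrite (@g_addr_socle idfun) // gtc; congr (_ + _); apply/eqP.
  rewrite -subr_eq0; apply/eqP; apply: (@socle_hm_eq0 idfun) => [|z].
    by rewrite socleB // (@g_socle).
  by rewrite mulrBl; apply: (@g_socle_hm idfun).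
have [E _] := c_slope _ _ _ ps ns (pi_neq_sub1 (tc (pi x))).
move: E; rewrite sl1 ?pi_neq_sub1 // tc1 mulr1 => /eqP.
by rewrite subr_eq gtc addrC => /eqP.
Qed.
End Socle.

(** * The Teichmueller group and the decomposition of K *)

Section Teichmuller.
Variables (R : finComUnitRingType) (F : finFieldType) (pi : {rmorphism R -> F}).
Hypothesis pi_eq0 : forall x, (pi x == 0) = (x \isn't a GRing.unit).
Hypothesis pi_surj : forall y, exists x, y = pi x.

(** The fibres of [pi] are cosets of the nonunits, so they all have the same size. *)
Lemma resq_card : resq R = #|F|.
Proof.
rewrite /resq /rad.
have -> : #|[set: R]| = (#|F| * #|nonunits R|)%N.
  transitivity (\sum_(y : F) #|nonunits R|)%N; last by rewrite sum_nat_const.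
  rewrite cardsT -[LHS]sum1_card (partition_big pi predT) //=.
  apply: eq_bigr => y _; have [x0 ->] := pi_surj y.
  rewrite sum1_card -[RHS](card_imset _ (addrI x0)); apply: eq_card => x.
  rewrite [LHS]unfold_in; apply/eqP/imsetP => [px|[z + ->]].
    by exists (x - x0); rewrite ?inE -?pi_eq0 ?rmorphB /= ?px ?subrr // addrC subrK.
  by rewrite inE -pi_eq0 rmorphD /= => /eqP ->; rewrite addr0.
by rewrite mulnK // card_gt0; apply/set0Pn; exists 0; rewrite inE unitr0.
Qed.

Variable T : {group {unit R}}.
Hypothesis cardT : #|T| = #|F|.-1.

(** If [t] in [T] has residue 1, then [t - 1] times the sum of the powers of [t] is 0, and that sum
    has residue [#|F| - 1 = -1], hence is a unit. *)
Lemma teichmuller_inj : {in T &, injective (fun t => pi (val t))}.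
Proof.
move=> t1 t2 T1 T2 /= e12.
have piu (u : {unit R}) : pi (val u) != 0 by rewrite pi_eq0 negbK; apply: valP.
have Tt : (t1 * t2^-1)%g \in T by rewrite groupM ?groupV.
set t := (t1 * t2^-1)%g in Tt.
have pt : pi (val t) = 1.
  rewrite /t FinRing.val_unitM FinRing.val_unitV rmorphM rmorphV ?(valP t2) //= e12 divff //; exact: piu.
have tX : val t ^+ #|T| = 1 by rewrite -FinRing.val_unitX expg_cardG.
have /eqP : val t ^+ #|T| - 1 = 0 by rewrite tX subrr.
rewrite subrX1 => /eqP E.
have uS : \sum_(i < #|T|) val t ^+ i \is a GRing.unit.
  rewrite -[_ \is a _]negbK -pi_eq0 rmorph_sum /= (eq_bigr (fun=> 1)) => [|i _]; last first.
    by rewrite rmorphXn /= pt expr1n.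
  rewrite sumr_const card_ord cardT; apply/eqP => E1.
  have := natr_card_finField F; rewrite card_neq0_finField mulrS.
  have -> : #|[pred x : F | x != 0]| = #|F|.-1 by rewrite [in RHS]card_neq0_finField.
  by rewrite E1 addr0 => /eqP; rewrite oner_eq0.
have {}E : val t = 1.
  by apply/eqP; rewrite -subr_eq0 -(mulIr_eq0 _ (mulIr uS)) E.
by apply/eqP; rewrite eq_mulgV1; apply/eqP/val_inj.
Qed.

Lemma teichmuller_surj y : y != 0 -> exists2 t, t \in T & pi (val t) = y.
Proof.
move=> y0; have : y \in [set pi (val t) | t in T].
  suff -> : [set pi (val t) | t in T] = [set x | x != 0] by rewrite inE.
  apply/eqP; rewrite eqEcard (card_in_imset teichmuller_inj) cardT; apply/andP; split.
    apply/subsetP=> _ /imsetP[t _ ->]; rewrite inE pi_eq0 negbK; exact: valP.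
  by rewrite cardsE card_neq0_finField.
by case/imsetP=> t tT ->; exists t.
Qed.

Definition teichmuller (y : F) : R :=
  if y == 0 then 0 else val (odflt 1%g [pick t in T | pi (val t) == y]).

Lemma teichmullerP y : y != 0 ->
  exists t, [/\ t \in T, teichmuller y = val t & pi (val t) = y].
Proof.
move=> y0; rewrite /teichmuller (negbTE y0); case: pickP => [t /andP[tT /eqP E]|H].
  by exists t.
by have [t tT E] := teichmuller_surj y0; have := H t; rewrite tT E eqxx.
Qed.

Lemma teichmuller0 : teichmuller 0 = 0.
Proof. by rewrite /teichmuller eqxx. Qed.

Lemma teichmullerK : cancel teichmuller pi.
Proof.
move=> y; have [->|/teichmullerP[t [_ -> //]]] := eqVneq y 0.
by rewrite teichmuller0 rmorph0.
Qed.

Lemma teichmuller_val t : t \in T -> teichmuller (pi (val t)) = val t.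
Proof.
move=> tT; have pt : pi (val t) != 0 by rewrite pi_eq0 negbK; apply: valP.
by have [s [sT -> /(teichmuller_inj sT tT) ->]] := teichmullerP pt.
Qed.

Lemma teichmuller1 : teichmuller 1 = 1.
Proof. by rewrite -[1 in LHS](rmorph1 pi) (teichmuller_val (group1 T)). Qed.

Lemma teichmullerM : {morph teichmuller : x y / x * y}.
Proof.
move=> x y.
have [->|/teichmullerP[s [sT -> <-]]] := eqVneq x 0; first by rewrite mul0r !teichmuller0 mul0r.
have [->|/teichmullerP[t [tT -> <-]]] := eqVneq y 0; first by rewrite mulr0 !teichmuller0 mulr0.
by rewrite -rmorphM -FinRing.val_unitM teichmuller_val ?groupM.
Qed.

Variable K : {group {unit R}}.
Hypothesis KTU : K \subset (T * U0 R)%g.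

Lemma I0_socle s : (s \in I0 R) = socle pi s.
Proof.
rewrite /socle !inE pi_eq0; congr (_ && _); apply: eq_forallb => x.
by rewrite inE pi_eq0.
Qed.

Definition additive_part : {set R} := [set a | socle pi a && (1 + a \in Kset K)].

Lemma additive_partP a :
  reflect (socle pi a /\ exists2 k, k \in K & 1 + a = val k) (a \in additive_part).
Proof.
rewrite inE; apply: (iffP andP) => -[sa].
  by case/imsetP=> k kK E; split=> //; exists k.
by case=> k kK E; split=> //; apply/imsetP; exists k.
Qed.

Lemma additive_part0 : 0 \in additive_part.
Proof.
by apply/additive_partP; split; [exact: socle0 | exists 1%g; rewrite ?group1 ?addr0].
Qed.

Lemma additive_partB a b : a \in additive_part -> b \in additive_part -> a - b \in additive_part.
Proof.
move=> /additive_partP[sa [k kK Ek]] /additive_partP[sb [l lK El]].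
apply/additive_partP; split; first exact: socleB.
exists (k * l^-1)%g; rewrite ?groupM ?groupV //.
have sm s t : socle pi s -> socle pi t -> s * t = 0.
  by move=> hs /socle_pi; apply: socle_mul0.
have ul : val l \is a GRing.unit := valP l.
(* The identity [(1 + a - b) * (1 + b) = 1 + a] holds because products in the socle vanish. *)
apply: (mulIr ul); rewrite FinRing.val_unitM mulrVK // -Ek -El.
by rewrite mulrDr mulr1 mulrDl mul1r mulrBl !sm // subrr addr0 -addrA subrK.
Qed.

Lemma additive_part_pure : pure K -> forall s, (forall r, r * s \in additive_part) -> s = 0.
Proof.
move=> pK s H; pose I := [set r * s | r : R].
have II : is_ideal I.
  split; first by apply/imsetP; exists 0; rewrite ?mul0r.
    move=> _ _ /imsetP[x _ ->] /imsetP[y _ ->].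
    by apply/imsetP; exists (x - y); rewrite ?mulrBl.
  by move=> r _ /imsetP[x _ ->]; apply/imsetP; exists (r * x); rewrite ?mulrA.
have IK x : x \in I -> 1 + x \in Kset K.
  by case/imsetP=> r _ ->; have := H r; rewrite inE => /andP[].
have : s \in I by apply/imsetP; exists 1; rewrite ?mul1r.
by rewrite (pK I II IK) inE => /eqP.
Qed.

(* Since [|T| = q - 1] and [q I0 = 0], the [q]-th power of an element of
   [K <= T U0] is its component in [T], which therefore lies in [K]. *)
Lemma K_decomposition k : k \in K ->
  exists c a, [/\ c != 0, a \in additive_part & val k = teichmuller c * (1 + a)].
Proof.
move=> kK; have /imset2P[t u tT uU Ek] := subsetP KTU k kK.
have [a Ea] : exists a, val u = 1 + a by exists (val u - 1); rewrite addrC subrK.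
have sa : socle pi a by have := uU; rewrite inE I0_socle Ea addrAC subrr add0r.
have uX : (u ^+ #|F| = 1)%g.
  apply: val_inj; rewrite FinRing.val_unitX Ea.
  have E n : (1 + a) ^+ n = 1 + a *+ n.
    elim: n => [|n IHn]; first by rewrite expr0 mulr0n addr0.
    rewrite exprS IHn mulrDr mulr1 mulrDl mul1r.
    by rewrite (socle_mul0 sa) ?addr0 ?mulrS ?addrA // rmorphMn /= (socle_pi sa) mul0rn.
  by rewrite E -mulr_natr (socle_mul0 sa) ?addr0 // rmorph_nat natr_card_finField.
have tX : (t ^+ #|F| = t)%g.
  have -> : #|F| = #|T|.+1 by rewrite cardT card_neq0_finField.
  by rewrite expgS expg_cardG // mulg1.
have tK : t \in K.
  by rewrite -tX -[(t ^+ _)%g]mulg1 -uX -expgMn -?Ek ?groupX //; apply/val_inj/mulrC.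
exists (pi (val t)), a; split.
- by rewrite pi_eq0 negbK; apply: valP.
- apply/additive_partP; split=> //; exists u => //.
  by rewrite -(mulKg t u) -Ek groupM ?groupV.
by rewrite teichmuller_val // -Ea Ek.
Qed.
End Teichmuller.

(** * Normalising an automorphism at 0 and 1 *)

Local Open Scope group_scope.

Theorem theorem6p4 (R : finComUnitRingType) (K T : {group {unit R}}) :
  local_ring R -> not_field R -> pure K ->
  #|T| = (resq R).-1 ->
  K \subset T * U0 R ->
  cyc_normal K.
Proof.
move=> locR [w [w0 wN]] pK cT KTU g gaut.
have [F [pi [pi0 pi_surj]]] := exists_residue_field locR.
rewrite (resq_card pi0 pi_surj) in cT.
(* The pair [(x, y)] lies in the relation of [r = y - x], as 1 is in [K], and [g] preserves this
   relation. *)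
have rel x y : exists2 k, k \in K & (g y - g x = (y - x) * val k)%R.
  have : cyc_rel K (y - x)%R (g x) (g y).
    by rewrite gaut; apply/exists_inP; exists 1; rewrite ?group1 ?mulr1.
  by case/exists_inP=> k kK /eqP; exists k.
have [k1 k1K] := rel 0%R 1%R; rewrite subr0 mul1r => Ek1.
have uk1 : val k1 \is a GRing.unit := valP k1.
pose h x := ((g x - g 0) / val k1)%R.
have h0 : (h 0 = 0)%R by rewrite /h subrr mul0r.
have h1 : (h 1 = 1)%R by rewrite /h Ek1 mulrV.
have uk1V : (val k1)^-1%R \is a GRing.unit by rewrite unitrV.
have h_inj : injective h by move=> x y /(mulIr uk1V) /addIr /perm_inj.
(* The multipliers of [h] are those of [g] divided by [k1], hence still in [K]. *)
have h_rel x y : exists c a, [/\ (c != 0)%R, a \in additive_part pi K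
    & (h y - h x = (y - x) * teichmuller pi T c * (1 + a))%R].
  have [k kK Ek] := rel x y.
  have [c [a [c0 aA E]]] := K_decomposition pi0 cT KTU (groupM kK (groupVr k1K)).
  exists c, a; split=> //.
  by rewrite -mulrA -E FinRing.val_unitM mulrA -Ek /h -mulrBl opprB addrA subrK.
have nf : exists2 w : R, (w != 0)%R & pi w = 0%R by exists w => //; apply/eqP; rewrite pi0.
have A_soc a : a \in additive_part pi K -> socle pi a by case/additive_partP.
have gE x : g x = (val k1 * h x + g 0)%R by rewrite /h mulrC divrK // subrK.
have hbij : bijective h by apply: injF_bij.
have [hid|[hD hM]] := g_id_or_morphism pi0 (teichmullerK pi0 cT) (teichmuller0 _ _)
  (teichmuller1 pi0 cT) (teichmullerM pi0 cT) A_soc (additive_part0 pi K)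
  (additive_partB (K := K)) (additive_part_pure pK) h_inj h0 h1 h_rel nf.
  exists k1, (g 0%R), idfun; split; first by exists id.
  by move=> x; rewrite gE hid.
have hB : zmod_morphism h.
  by move=> x y; apply: (addIr (h y)); rewrite -hD !subrK.
have hMM : monoid_morphism h by split.
pose m1 := GRing.isZmodMorphism.Build R R h hB.
pose m2 := GRing.isMonoidMorphism.Build R R h hMM.
pose sigma : {rmorphism R -> R} := HB.pack h m1 m2.
by exists k1, (g 0%R), sigma.
Qed.
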